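(* Let $K$ be a field and let $G$ be a finite simple gap-free graph without isolated vertices, with vertex set $\{1,\ldots,n\}$ and with $m$ edges. Let $\sigma$ be an arbitrary graded reverse lexicographic order on $K[x_1,\ldots,x_n]$ (i.e. with respect to an arbitrary ordering of the variables). Order the edges of $G$ by declaring $\{i_1,i_2\}\preceq\{j_1,j_2\}$ if and only if $x_{i_1}x_{i_2}\preceq_\sigma x_{j_1}x_{j_2}$, and name the edges $e_1,\ldots,e_m$ so that $e_1\succ e_2\succ\cdots\succ e_m$. Let $I_G\subseteq K[y_1,\ldots,y_m]$ be the toric ideal of $G$, where $y_i$ corresponds to $e_i$, and let $\tau$ be the lexicographic order on $K[y_1,\ldots,y_m]$ with $y_1\succ_\tau y_2\succ_\tau\cdots\succ_\tau y_m$. Then the initial ideal $in_\tau(I_G)$ is generated by squarefree monomials.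
   Context: For an edge $e=\{i,j\}$ of $G$, the edge monomial is $M_e=x_ix_j\in K[x_1,\ldots,x_n]$. The toric ideal $I_G$ is the kernel of the surjective $K$-algebra homomorphism $K[y_1,\ldots,y_m]\to K[M_{e_1},\ldots,M_{e_m}]$, $y_i\mapsto M_{e_i}$. A graph $G$ is gap-free if for any two edges $\{v_1,v_2\},\{w_1,w_2\}\in E(G)$ with $v_1,v_2,w_1,w_2$ all distinct there exist $i,j\in\{1,2\}$ such that $\{v_i,w_j\}\in E(G)$. *)

(* Defs.v *)
From mathcomp Require Import all_boot all_order all_fingroup all_algebra.
From mathcomp Require Import mpoly.

Set Implicit Arguments.
Unset Strict Implicit.
Unset Printing Implicit Defensive.

Local Open Scope ring_scope.

(* A graph on the vertex set 'I_n is given by its set of edges, and an edge by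
   the set of its two ends. *)
Section Graphs.
Variable n : nat.
Implicit Type E : {set {set 'I_n}}.

Definition simple_graph E : Prop := forall A, A \in E -> #|A| = 2%N.

Definition no_isolated_vertex E : Prop :=
  forall v, exists2 A, A \in E & v \in A.

Definition gap_free E : Prop :=
  forall v1 v2 w1 w2 : 'I_n,
    [set v1; v2] \in E -> [set w1; w2] \in E -> uniq [:: v1; v2; w1; w2] ->
    [|| [set v1; w1] \in E, [set v1; w2] \in E,
        [set v2; w1] \in E | [set v2; w2] \in E].

End Graphs.

Section MonomialOrders.
Variable n : nat.
Implicit Types a b : 'X_{1..n}.

(* The order that 'X_{1..n} carries in the library is the graded
   lexicographic one, so neither of the two orders below is that order. *)

(* x_0 > x_1 > ... > x_(n-1) *)
Definition lex a b : bool :=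
  (a == b) ||
  [exists k : 'I_n, [forall j : 'I_n, (j < k)%N ==> (a j == b j)]
                    && (a k < b k)%N].

(* x_(s 0) > x_(s 1) > ... > x_(s (n-1)) *)
Definition degrevlex (s : 'S_n) a b : bool :=
  [|| a == b, (mdeg a < mdeg b)%N
    | (mdeg a == mdeg b) &&
      [exists k : 'I_n,
         [forall j : 'I_n, (k < j)%N ==> (a (s j) == b (s j))]
         && (b (s k) < a (s k))%N]].

Definition squarefree_mnm a : Prop := forall i, (a i <= 1)%N.

End MonomialOrders.

Section Ideals.
Variables (K : fieldType) (n : nat).
Implicit Types (S I : {mpoly K[n]} -> Prop) (p : {mpoly K[n]}).

Definition ideal_gen S p : Prop :=
  exists (r : nat) (c g : 'I_r -> {mpoly K[n]}),
    (forall i, S (g i)) /\ p = \sum_i c i * g i.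

Definition is_initial_mnm (ord : rel 'X_{1..n}) p (u : 'X_{1..n}) : Prop :=
  u \in msupp p /\ forall v, v \in msupp p -> ord v u.

Definition initial_ideal (ord : rel 'X_{1..n}) I : {mpoly K[n]} -> Prop :=
  ideal_gen (fun q =>
    exists p u, [/\ I p, is_initial_mnm ord p u & q = 'X_[u]]).

Definition generated_by_squarefree_monomials I : Prop :=
  exists S,
    (forall q, S q -> exists2 u, squarefree_mnm u & q = 'X_[u]) /\
    (forall p, I p <-> ideal_gen S p).

End Ideals.

Section EdgeRings.
Variables (n m : nat).
Implicit Types A B : {set 'I_n}.

(* The exponent vector of the edge monomial: [mesym1 A] is the indicator
   of [A]. *)
Definition edge_mnm A : 'X_{1..n} := mesym1 A.

Definition edge_le (s : 'S_n) A B : bool :=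
  degrevlex s (edge_mnm A) (edge_mnm B).

Definition edge_lt (s : 'S_n) A B : bool := (A != B) && edge_le s A B.

Definition decreasing_edge_naming (s : 'S_n) (E : {set {set 'I_n}})
    (e : m.-tuple {set 'I_n}) : Prop :=
  e =i E /\
  (forall i j : 'I_m, (i < j)%N -> edge_lt s (tnth e j) (tnth e i)).

Definition toric_ideal (K : fieldType) (e : m.-tuple {set 'I_n})
    (p : {mpoly K[m]}) : Prop :=
  p \mPo [tuple 'X_[K, edge_mnm (tnth e i)] | i < m] = 0.

End EdgeRings.

(* Main.v *)
Require Import Defs.
From mathcomp Require Import all_boot all_order all_fingroup all_algebra.
From mathcomp Require Import mpoly zify.

Set Implicit Arguments.
Unset Strict Implicit.
Unset Printing Implicit Defensive.

Import Order.TTheory GRing.Theory Num.Theory.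

(** A monomial lies in the initial ideal iff some lexicographically smaller
    monomial has the same image, so it suffices to find, below every such [u], a
    squarefree one. Let [v] be smaller than [u] with the same image, and let
    [y_k], for the edge [{a, b}] with [b] the smaller variable, be the largest
    variable in which they differ. Call an edge red if its exponent is larger
    in [u] than in [v], and blue if its variable is smaller than [y_k].
    The balance of [u - v] at every vertex yields a closed walk through [{a, b}]
    that alternates between red and blue edges, and any such walk without
    repeated red edge gives a squarefree reducible divisor of [u], the product
    of its red edges. It remains to see that a shortest one repeats no red
    edge. If [{p, q}] is traversed twice in the same direction, the walk splits.
    Otherwise it consists of [{p, q}], an odd closed walk at [q] and one at [p],
    both starting and ending with blue edges. We may assume that the one at [q]
    contains [{a, b}], or that [p = a] and [q = b]. The walk at [p] avoids [b],
    else there is a shortcut, so every edge of it has an end whose variable is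
    smaller than that of [b]; being odd, it has an edge with two such ends.
    Gap-freeness joins this edge to a red edge of the walk at [q], which can be
    taken to be [{a, b}] if that walk contains it, by an edge that is
    automatically blue, and this gives a shorter closed walk. *)

Lemma not_uniq_map_split (T T' : eqType) (f : T -> T') (s : seq T) :
  ~~ uniq (map f s) ->
  exists s1 d1 s2 d2 s3, s = s1 ++ d1 :: s2 ++ d2 :: s3 /\ f d1 = f d2.
Proof.
elim: s => //= d s IH; rewrite negb_and negbK =>
  /orP[/mapP[d' /path.splitPr sE fE]|].
  by case: sE => s2 s3; exists [::], d, s2, d', s3.
by case/IH=> s1 [d1 [s2 [d2 [s3 [-> fE]]]]]; exists (d :: s1), d1, s2, d2, s3.
Qed.

(** * Alternating walks *)

Section AlternatingWalks.
Variables (V : finType) (red bl : rel V).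
Implicit Types (x y z p q : V) (d : V * V) (s t : seq (V * V)).

(* The darts of [s] are the red edges of the walk, with their direction; the
   blue edges link the end of a dart to the start of the next one, [x] to the
   start of the first dart, and the end of the last one to [y]. *)
Fixpoint awalk x s y : bool :=
  if s is d :: s' then [&& bl x d.1, red d.1 d.2 & awalk d.2 s' y] else bl x y.

Definition closed_awalk s : bool :=
  if s is d :: s' then red d.1 d.2 && awalk d.2 s' d.1 else false.

Definition dart_edge d : {set V} := [set d.1; d.2].

Lemma dart_edge_eq d1 d2 :
  dart_edge d1 = dart_edge d2 -> d1 = d2 \/ d1 = (d2.2, d2.1).
Proof.
case: d1 d2 => [x1 y1] [x2 y2] /setP e /=.
have := e x1; have := e y1; have := e x2; have := e y2.
rewrite !inE !eqxx !orbT /= => /orP e1 /orP e2 /esym/orP e3 /esym/orP e4.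
case: e1 e2 e3 e4 => /eqP e1 [] /eqP e2 [] /eqP e3 [] /eqP e4;
  by [left; congr pair; congruence | right; congr pair; congruence].
Qed.

Definition rev_walk s := rev [seq (d.2, d.1) | d <- s].

Lemma awalk_cat x s1 d s2 y :
  awalk x (s1 ++ d :: s2) y =
  [&& awalk x s1 d.1, red d.1 d.2 & awalk d.2 s2 y].
Proof. by elim: s1 x => [|d1 s1 IH] x //=; rewrite IH !andbA. Qed.

Lemma closed_awalk_rot s1 s2 :
  closed_awalk (s1 ++ s2) -> closed_awalk (s2 ++ s1).
Proof.
case: s1 s2 => [|d1 s1] [|d2 s2] //=; rewrite ?cats0 ?cat0s ?cat_rcons //.
rewrite !awalk_cat => /and4P[rd1 w1 rd2 w2].
by rewrite rd1 rd2 w1 w2.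
Qed.

Lemma size_rev_walk s : size (rev_walk s) = size s.
Proof. by rewrite size_rev size_map. Qed.

Lemma mem_rev_walk x y s : ((x, y) \in rev_walk s) = ((y, x) \in s).
Proof.
rewrite mem_rev; apply/mapP/idP => [[[y' x'] ys [-> ->]] //|ys].
by exists (y, x).
Qed.

Lemma awalk_red x s y d : awalk x s y -> d \in s -> red d.1 d.2.
Proof.
by move=> + /path.splitPr sE; case: sE => ? ?; rewrite awalk_cat => /and3P[].
Qed.

Lemma closed_awalk_red s d : closed_awalk s -> d \in s -> red d.1 d.2.
Proof.
case: s => //= d1 s /andP[r1 w1]; rewrite inE => /orP[/eqP-> //|].
exact: awalk_red w1.
Qed.

Hypotheses (redC : ssrbool.symmetric red) (blC : ssrbool.symmetric bl).

Lemma awalk_rev x s y : awalk x s y -> awalk y (rev_walk s) x.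
Proof.
elim: s x => [|d s IH] x /=; first by rewrite blC.
case/and3P=> bxd rd /IH w.
by rewrite /rev_walk /= rev_cons -cats1 awalk_cat w /= redC rd blC.
Qed.

Lemma connect_awalk d d' y :
  connect [rel d d' | bl d.2 d'.1 && red d'.1 d'.2] d d' -> bl d'.2 y ->
  exists s, awalk d.2 s y.
Proof.
move=> /connectP[s]; elim: s d => [|d1 s IH] d /=.
  by move=> _ -> bd; exists [::].
move=> /andP[/andP[b1 r1] ps] ld' bd'.
have [s' ws'] := IH _ ps ld' bd'.
by exists (d1 :: s'); rewrite /= b1 r1.
Qed.

(* From a vertex [z] of a closed odd walk at [p], both continuations lead back
   to [p]: the one leaving [z] along a blue edge, and the one entering [z] by
   an extra blue edge from [y] and leaving it along a red edge. *)
Lemma awalk_from_loop p s z : awalk p s p ->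
  (z == p) || has (fun d => z \in dart_edge d) s ->
  (exists2 t, (size t <= size s)%N & awalk z t p) /\
  (forall y, bl y z -> exists2 t, (size t <= size s)%N & awalk y t p).
Proof.
move=> ws /orP[/eqP->|]; first by split=> [|y byp]; [exists s|exists [::]].
have suf x s' : awalk p s' p -> size s' = size s -> (z, x) \in s' ->
  (exists2 t, (size t <= size s)%N & awalk z t p) /\
  (forall y, bl y z -> exists2 t, (size t <= size s)%N & awalk y t p).
  move=> + <- /path.splitPr s'E; case: s'E => s1 s2.
  rewrite awalk_cat => /and3P[w1 rzx w2]; split=> [|y byz].
    exists (rev_walk s1); last exact: awalk_rev.
    by rewrite size_rev_walk size_cat leq_addr.
  exists ((z, x) :: s2); last by rewrite /= byz rzx.
  by rewrite size_cat leq_addl.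
case/hasP=> -[x1 x2] xs; rewrite !inE /= => /orP[] /eqP zE.
  by apply: (suf x2 s); rewrite // zE.
apply: (suf x1 (rev_walk s)); first exact: awalk_rev.
  exact: size_rev_walk.
by rewrite mem_rev_walk zE.
Qed.

(** * Shortening a closed walk that repeats a red edge *)

Section Shortening.
(** In the application [big] holds at the vertices whose variable is smaller than that of [b];
    [big_cover] and [big_bl] are what is retained of the edge order. *)
Variables (adj : rel V) (big : pred V) (a b : V).
Hypothesis adj_irr : irreflexive adj.
Hypothesis gap_free_adj : forall v1 v2 w1 w2, adj v1 v2 -> adj w1 w2 ->
  uniq [:: v1; v2; w1; w2] ->
  [|| adj v1 w1, adj v1 w2, adj v2 w1 | adj v2 w2].
Hypothesis red_adj : subrel red adj.
Hypothesis bl_adj : subrel bl adj.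
Hypothesis big_cover : forall x y, red x y || bl x y -> x != b -> y != b ->
  big x || big y.
Hypothesis big_bl : forall x y, adj x y -> big x || big y -> bl x y.

(** Keeping [{a, b}] in the walk keeps [y_k] in the product of its red edges, which makes it
    lexicographically larger than the product of the blue ones. *)
Definition through_ab s := ((a, b) \in s) || ((b, a) \in s).

(** The walk has one more blue edge than red ones, so it is odd, and each edge switches membership
    in [big]. *)
Lemma awalk_alternates (D : pred V) x s y :
  (forall u v, D u -> D v -> red u v || bl u v -> big u (+) big v) ->
  awalk x s y -> D x -> all (fun d => D d.1 && D d.2) s -> D y ->
  big x (+) big y.
Proof.
move=> alt + + + Dy; elim: s x => [|[c d] s IH] x /=.
  by move=> bxy Dx _; apply: alt => //; rewrite bxy orbT.
case/and3P=> bxc rcd ws Dx /andP[/andP[Dc Dd] Ds].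
have := IH d ws Dd Ds.
have := alt x c Dx Dc; rewrite bxc orbT => /(_ isT).
have := alt c d Dc Dd; rewrite rcd => /(_ isT).
by case: (big x) (big c) (big d) (big y) => [] [] [] [].
Qed.

Lemma shorten_two_loops p q s1 s2 :
  red p q -> awalk q s1 q -> awalk p s2 p ->
  (p, q) = (a, b) \/ through_ab s1 ->
  exists s, [/\ closed_awalk s, through_ab s
             & (size s < (size s1 + size s2).+2)%N].
Proof.
move=> rpq w1 w2 ab_in.
set goal := exists s, _.
(* Follow [(p, q)], then [s1] or its reverse through [{x, y}], then [t] back to [p]: the second
   traversal of [{p, q}] is saved. *)
have close x y t : ((x, y) \in s1) || ((y, x) \in s1) ->
    (p, q) = (a, b) \/ ((x, y) == (a, b)) || ((x, y) == (b, a)) ->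
    (size t <= size s2)%N -> awalk y t p -> goal.
  have suf x' y' s1' : awalk q s1' q -> size s1' = size s1 ->
      (x', y') \in s1' ->
      (p, q) = (a, b) \/ ((x', y') == (a, b)) || ((x', y') == (b, a)) ->
      (size t <= size s2)%N -> awalk y' t p -> goal.
    rewrite /goal => w1' <- /path.splitPr s1E.
    case: s1E w1' => s3 s4; rewrite awalk_cat => /and3P[w3 rxy w4] xyab st wt.
    exists ((p, q) :: s3 ++ (x', y') :: t); split.
    - by rewrite /= rpq awalk_cat w3 /= rxy wt.
    - rewrite /through_ab; case: xyab => [<-|xyab]; first by rewrite mem_head.
      rewrite !(inE, mem_cat).
      by case/orP: xyab => /eqP<-; rewrite eqxx ?orbT.
    - rewrite /= !size_cat /=; lia.
  case/orP=> xs; first exact: (suf _ _ s1).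
  by apply: (suf _ _ (rev_walk s1)); rewrite ?size_rev_walk ?mem_rev_walk //;
     exact: awalk_rev.
(* If [(p, q)] is [(a, b)], the first dart of [s1] will do; it exists because a blue edge is not a
   loop. Otherwise [{x, y}] is [{a, b}]. *)
have [x [y [xys xyab]]] : exists x y, (x, y) \in s1 /\
    ((p, q) = (a, b) \/ ((x, y) == (a, b)) || ((x, y) == (b, a))).
  case: ab_in => [pqE|]; last first.
    by case/orP=> ?; [exists a, b|exists b, a]; split=> //; right;
       rewrite eqxx ?orbT.
  case: s1 w1 {close goal} => [/bl_adj|[x y] s1 _]; first by rewrite adj_irr.
  by exists x, y; rewrite mem_head; split=> //; left.
have closey t : (size t <= size s2)%N -> awalk y t p -> goal.
  by apply: (close x); rewrite // xys.
have closex t : (size t <= size s2)%N -> awalk x t p -> goal.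
  apply: (close y); rewrite ?xys ?orbT //; case: xyab => [|xyab]; [by left|].
  by right; move: xyab; rewrite !xpair_eqE ![(y == _) && _]andbC orbC.
(* These are the vertices of the loop at [p]. There is a shortcut as soon as [x] or [y] lies in [D]
   or has a blue edge to [D]. *)
pose D := [pred z | (z == p) || has (fun d => z \in dart_edge d) s2].
have Dx z t : D z -> z = x \/ z = y -> goal.
  move=> /(awalk_from_loop w2)[[t' st' wt'] _] zxy.
  by case: zxy => zE; [apply: (closex t')|apply: (closey t')]; rewrite // -zE.
have Dbl z : D z -> bl x z || bl y z -> goal.
  move=> /(awalk_from_loop w2)[_ wt] /orP[] /wt[t st wt'].
    exact: closex wt'.
  exact: closey wt'.
have [Db|NDb] := boolP (D b).
  case: xyab => [[pa qb]|xyab]; last first.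
    apply: Dx (Db) _ => //; case/orP: xyab => /eqP[-> ->]; by [left|right].
  have [[t st wt] _] := awalk_from_loop w2 Db.
  exists ((p, q) :: t); split; first by rewrite /= rpq qb.
    by rewrite /through_ab pa qb mem_head.
  by rewrite /= !ltnS (leq_trans st) // leq_addl.
have axy : adj x y by exact: red_adj (awalk_red w1 xys).
have [Dx'|NDx] := boolP (D x); first by apply: Dx Dx' _; left.
have [Dy'|NDy] := boolP (D y); first by apply: Dx Dy' _; right.
(* Gap-freeness joins two adjacent big vertices of [D] to [{x, y}] by an edge with a big end, hence
   blue. *)
have [|nobig] := boolP [exists z, exists z',
    [&& D z, D z', adj z z', big z & big z']].
  case/existsP=> z /existsP[z' /and5P[Dz Dz' zz' bz bz']].
  have neq u v : adj u v -> u != v.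
    by apply: contraTneq => ->; rewrite adj_irr.
  have neqD u v : D u -> ~~ D v -> v != u.
    by move=> Du; apply: contraNneq => ->.
  have: uniq [:: x; y; z; z'].
    by rewrite /= !inE !negb_or (neq x y) ?(neq z z') ?neqD.
  case/(gap_free_adj axy zz')/or4P=> e.
  - by apply: (Dbl z) => //; rewrite (big_bl e) ?bz ?orbT.
  - by apply: (Dbl z') => //; rewrite (big_bl e) ?bz' ?orbT.
  - by apply: (Dbl z) => //; rewrite (big_bl e) ?bz ?orbT.
  - by apply: (Dbl z') => //; rewrite (big_bl e) ?bz' ?orbT.
(* As [b] is not in [D], every red or blue edge within [D] now has exactly one big end, which an odd
   loop forbids. *)
suff: big p (+) big p by rewrite addbb.
have Dp : D p by rewrite /= eqxx.
apply: (@awalk_alternates D p s2 p) => //.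
  move=> u v Du Dv e.
  have auv : adj u v by case/orP: e => [/red_adj|/bl_adj].
  have: big u || big v.
    by apply: big_cover e _ _; apply: contraNneq NDb => <-.
  move: nobig; rewrite negb_exists => /forallP/(_ u).
  rewrite negb_exists => /forallP/(_ v).
  by rewrite Du Dv auv; case: (big u); case: (big v).
by apply/allP => d ds; rewrite /D /=; apply/andP; split; apply/orP; right;
   apply/hasP; exists d; rewrite // !inE eqxx ?orbT.
Qed.

(** The two traversals cut the walk into [s1] and [s2]. If their directions agree, each piece closes
    up with one copy of the red edge; if not, the pieces are loops at its two ends. *)
Lemma shorten_closed_awalk s :
  closed_awalk s -> through_ab s -> ~~ uniq (map dart_edge s) ->
  exists s', [/\ closed_awalk s', through_ab s' & (size s' < size s)%N].
Proof.
move=> cs abs /not_uniq_map_split[s0 [d1 [s1 [d2 [s3 [sE d12]]]]]].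
pose s2 := s3 ++ s0.
have ssE : size s = (size s1 + size s2).+2.
  by rewrite sE /s2 !size_cat /= !size_cat /=; lia.
have {}cs : closed_awalk (d1 :: s1 ++ d2 :: s2).
  by move: cs; rewrite sE => /closed_awalk_rot; rewrite /= -catA.
have memE d : d \in s = (d \in d1 :: s1 ++ d2 :: s2).
  rewrite sE !(mem_cat, inE).
  by case: (d == d1) (d \in s1) (d == d2) (d \in s3) (d \in s0)
    => [] [] [] [] [].
move: cs; rewrite /= awalk_cat => /and4P[r1 w1 r2 w2].
rewrite ssE.
have [dE|dE] := dart_edge_eq d12.
  subst d2.
  have : through_ab (d1 :: s1) || through_ab (d1 :: s2).
    move: abs; rewrite /through_ab !memE !(mem_cat, inE).
    by case/orP=> /or4P[] ->; rewrite ?orbT.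
  case/orP=> ?; [exists (d1 :: s1)|exists (d1 :: s2)]; split => //=.
  - by rewrite r1.
  - by lia.
  - by rewrite r1.
  - by lia.
case: d2 dE r2 w1 w2 {d12 sE} memE => u v /= -> /= ruv w1 w2 memE.
have: ((v, u) = (a, b) \/ through_ab s1) \/ ((u, v) = (a, b) \/ through_ab s2).
  move: abs; rewrite /through_ab !memE !(mem_cat, inE) !xpair_eqE.
  have [[-> ->]|nab] := (v, u) =P (a, b); first by left; left.
  have [[-> ->]|nba] := (u, v) =P (a, b); first by right; left.
  have -> : (a == v) && (b == u) = false.
    by apply/negP => /andP[/eqP e1 /eqP e2]; apply: nab; rewrite e1 e2.
  have -> : (a == u) && (b == v) = false.
    by apply/negP => /andP[/eqP e1 /eqP e2]; apply: nba; rewrite e1 e2.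
  rewrite [(b == v) && _]andbC [(b == u) && _]andbC.
  have -> : (a == v) && (b == u) = false.
    by apply/negP => /andP[/eqP e1 /eqP e2]; apply: nab; rewrite e1 e2.
  have -> : (a == u) && (b == v) = false.
    by apply/negP => /andP[/eqP e1 /eqP e2]; apply: nba; rewrite e1 e2.
  by rewrite /= => /orP[] /orP[] ->; rewrite ?orbT;
     [left; right|right; right|left; right|right; right].
have rvu : red v u by rewrite redC.
case=> e; first exact: shorten_two_loops rvu w1 w2 e.
by rewrite addnC; apply: shorten_two_loops ruv w2 w1 e.
Qed.

Lemma exists_uniq_closed_awalk s : closed_awalk s -> through_ab s ->
  exists s', [/\ closed_awalk s', through_ab s' & uniq (map dart_edge s')].
Proof.
have [k] := ubnP (size s); elim: k s => // k IH s sk cs abs.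
have [us|nus] := boolP (uniq (map dart_edge s)); first by exists s.
have [s' [cs' abs' ss']] := shorten_closed_awalk cs abs nus.
by apply: IH cs' abs'; apply: leq_trans ss' _.
Qed.

End Shortening.
End AlternatingWalks.

Lemma awalk_sub (V : finType) (red bl bl' : rel V) : subrel bl bl' ->
  forall x s y, awalk red bl x s y -> awalk red bl' x s y.
Proof.
move=> sub x s y; elim: s x => [|d s IH] x /=; first exact: sub.
by case/and3P=> /sub-> -> /IH.
Qed.

Local Open Scope ring_scope.

(** * Alternating walks from balanced edge weights *)

Section BalancedWeights.
Variables (V I : finType) (e : I -> {set V}) (h : I -> int).
Hypothesis e_edge : forall i, #|e i| = 2%N.
Hypothesis balanced : forall x, \sum_(i | x \in e i) h i = 0.

Definition pos_edge : rel V :=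
  fun x y => [exists i, (0 < h i) && (e i == [set x; y])].
Definition neg_edge : rel V :=
  fun x y => [exists i, (h i < 0) && (e i == [set x; y])].

(* If [a] were not reachable, weighting each vertex by +1 when it is reachable
   along a final positive edge and by -1 along a final negative edge would give
   every edge a total weight of the sign of [h], and a positive one to the edge
   [k], against the balance of [h]. *)
Lemma balanced_awalk k a b : 0 < h k -> e k = [set a; b] ->
  exists s, awalk pos_edge neg_edge b s a.
Proof.
move=> hk ek.
pose r := [rel d d' | neg_edge d.2 d'.1 && pos_edge d'.1 d'.2].
pose P x := [exists d, connect r (a, b) d && (d.2 == x)].
pose N x := [exists d, connect r (a, b) d && neg_edge d.2 x].
have [/existsP[d /andP[cd nd]]|NNa] := boolP (N a).
  exact: (connect_awalk cd nd).
have Pb : P b by apply/existsP; exists (a, b); rewrite connect0 eqxx.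
have PN x y : neg_edge x y -> P x -> N y.
  move=> nxy /existsP[d /andP[cd /eqP dx]]; apply/existsP; exists d.
  by rewrite cd dx.
have NP x y : pos_edge x y -> N x -> P y.
  move=> pxy /existsP[d /andP[cd nd]]; apply/existsP; exists (x, y).
  rewrite eqxx andbT; apply: connect_trans cd _; apply: connect1.
  by rewrite /= nd.
pose f x : int := (P x)%:Z - (N x)%:Z.
have leb (c d : bool) : (c -> d) -> c%:Z <= d%:Z.
  by case: c d => [] [] // /(_ isT).
have setC x y : [set x; y] = [set y; x] :> {set V} by rewrite setUC.
have edge_sum i x y : e i = [set x; y] -> \sum_(z in e i) f z = f x + f y.
  move=> ei; rewrite ei big_setU1 /= ?big_set1 // inE.
  by have := e_edge i; rewrite ei cards2; case: (x == y).
have split_edge i : exists x y, e i = [set x; y].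
  by have /eqP/cards2P[x [y [_ ->]]] := e_edge i; exists x, y.
(* Negative edges lead from [P] to [N] and positive ones from [N] to [P], so [f x + f y] never has
   the sign opposite to [h i]. *)
have term_ge0 i : 0 <= h i * \sum_(z in e i) f z.
  have [x [y ei]] := split_edge i; rewrite (edge_sum _ _ _ ei).
  case: (ltrgt0P (h i)) => [hi|hi|->]; last by rewrite mul0r.
  - have pxy : pos_edge x y by apply/existsP; exists i; rewrite hi ei eqxx.
    have pyx : pos_edge y x by apply/existsP; exists i; rewrite hi ei setC eqxx.
    apply: (mulr_ge0 (ltW hi)); rewrite /f.
    by have := leb _ _ (NP _ _ pxy); have := leb _ _ (NP _ _ pyx); lia.
  - have pxy : neg_edge x y by apply/existsP; exists i; rewrite hi ei eqxx.
    have pyx : neg_edge y x by apply/existsP; exists i; rewrite hi ei setC eqxx.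
    apply: (mulr_le0 (ltW hi)); rewrite /f.
    by have := leb _ _ (PN _ _ pxy); have := leb _ _ (PN _ _ pyx); lia.
have term_gt0 : 0 < h k * \sum_(z in e k) f z.
  rewrite (edge_sum _ _ _ ek); apply: (mulr_gt0 hk); rewrite /f Pb (negPf NNa).
  have pba : pos_edge b a by apply/existsP; exists k; rewrite hk ek setC eqxx.
  by have := leb _ _ (NP _ _ pba); lia.
have : \sum_i h i * \sum_(z in e i) f z = 0.
  under eq_bigr do rewrite mulr_sumr.
  rewrite (exchange_big_dep predT) //= big1 // => z _.
  by rewrite -mulr_suml balanced mul0r.
rewrite (bigD1 k) //= => sum0.
have : 0 < h k * \sum_(z in e k) f z +
           \sum_(i | i != k) h i * \sum_(z in e i) f z.
  by rewrite ltr_wpDr // sumr_ge0.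
by rewrite sum0 ltxx.
Qed.
End BalancedWeights.

(** * Edge monomials and the toric ideal *)

Section Monomials.
Variables (n m : nat) (e : m.-tuple {set 'I_n}).

Definition edge_image (u : 'X_{1..m}) : 'X_{1..n} :=
  (\sum_i edge_mnm (tnth e i) *+ u i)%MM.

Lemma edge_imageE u x :
  edge_image u x = (\sum_(i | x \in tnth e i) u i)%N.
Proof.
rewrite /edge_image mnm_sumE [RHS]big_mkcond /=; apply: eq_bigr => i _.
rewrite mulmnE /edge_mnm mnmE.
by case: (x \in _); rewrite ?mul1n ?mul0n.
Qed.

Lemma edge_imageD u v :
  edge_image (u + v)%MM = (edge_image u + edge_image v)%MM.
Proof.
by apply/mnmP => x; rewrite mnmDE !edge_imageE -big_split;
   apply: eq_bigr => i _; rewrite mnmDE.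
Qed.

Lemma edge_imageU i : edge_image U_(i)%MM = edge_mnm (tnth e i).
Proof.
apply/mnmP => x; rewrite edge_imageE /edge_mnm mnmE big_mkcond (bigD1 i) //=.
rewrite mnm1E eqxx big1 ?addn0; first by case: (x \in _).
by move=> j ji; rewrite mnm1E eq_sym (negPf ji) if_same.
Qed.

Lemma edge_mnm2 (x y : 'I_n) : x != y ->
  edge_mnm [set x; y] = (U_(x) + U_(y))%MM.
Proof.
move=> xy; apply/mnmP => z; rewrite /edge_mnm mnmE mnmDE !mnm1E !inE.
rewrite ![z == _]eq_sym.
by case: (eqVneq x z) => [<-|] //=; rewrite eq_sym (negPf xy).
Qed.

Lemma toric_monomialE (K : fieldType) (p : {mpoly K[m]}) :
  p \mPo [tuple 'X_[K, edge_mnm (tnth e i)] | i < m] =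
  \sum_(w <- msupp p) p@_w *: 'X_[edge_image w].
Proof.
rewrite comp_mpolyEX; apply: eq_bigr => w _; congr (_ *: _).
rewrite comp_mpolyX /edge_image (big_morph _ (@mpolyXD n K) (@mpolyX0 n K)).
by apply: eq_bigr => i _; rewrite tnth_mktuple mpolyXn.
Qed.

(** Otherwise the coefficient of [u] in [p] would survive as a coefficient of the image of [p],
    which is zero. *)
Lemma toric_same_image (K : fieldType) (p : {mpoly K[m]}) u :
  toric_ideal e p -> u \in msupp p ->
  exists v, [/\ v \in msupp p, v != u & edge_image v = edge_image u].
Proof.
rewrite /toric_ideal toric_monomialE => p0 up.
have [/hasP[v vp /andP[vu /eqP ev]]|/hasPn none] :=
  boolP (has (fun v => (v != u) && (edge_image v == edge_image u)) (msupp p)).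
  by exists v.
have := congr1 (fun q => q@_(edge_image u)) p0.
rewrite mcoeff0 raddf_sum /= (bigD1_seq u) //= mcoeffZ mcoeffX eqxx mulr1.
rewrite big_seq_cond big1 => [|v /andP[vp vu]].
  by rewrite addr0 => /eqP; rewrite mcoeff_eq0 up.
have := none v vp; rewrite vu /= => /negPf ev.
by rewrite mcoeffZ mcoeffX ev mulr0.
Qed.

Lemma toric_binomial (K : fieldType) u v : edge_image u = edge_image v ->
  @toric_ideal n m K e ('X_[u] - 'X_[v]).
Proof.
move=> euv; rewrite /toric_ideal comp_mpolyB.
suff tX w : 'X_[K, w] \mPo [tuple 'X_[K, edge_mnm (tnth e i)] | i < m] =
  'X_[edge_image w] by rewrite !tX euv subrr.
by rewrite toric_monomialE msuppX big_seq1 mcoeffX eqxx scale1r.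
Qed.

Lemma binomial_initial (K : fieldType) (u v : 'X_{1..m}) : lex v u -> v != u ->
  is_initial_mnm (@lex m) ('X_[K, u] - 'X_[v]) u.
Proof.
move=> vu nvu; split.
  by rewrite mcoeff_msupp mcoeffB !mcoeffX eqxx (negPf nvu) subr0 oner_eq0.
move=> w; rewrite mcoeff_msupp mcoeffB !mcoeffX.
have [<-|_] := eqVneq u w; first by rewrite /lex eqxx.
by have [<-|_] := eqVneq v w; last by rewrite subrr eqxx.
Qed.

Definition lex_reducible (u : 'X_{1..m}) :=
  exists v, [/\ lex v u, v != u & edge_image v = edge_image u].

Lemma initial_lex_reducible (K : fieldType) (u : 'X_{1..m}) :
  (exists p : {mpoly K[m]}, toric_ideal e p /\ is_initial_mnm (@lex m) p u) <->
  lex_reducible u.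
Proof.
split=> [[p [tp [up pmax]]]|[v [vu nvu euv]]].
  by have [v [vp vu ev]] := toric_same_image tp up;
     exists v; split=> //; apply: pmax.
exists ('X_[u] - 'X_[v]); split; last exact: binomial_initial.
exact: toric_binomial.
Qed.

Lemma generated_by_squarefree_of_reducible (K : fieldType) :
  (forall u, lex_reducible u ->
     exists w, [/\ lex_reducible w, squarefree_mnm w & (w <= u)%MM]) ->
  generated_by_squarefree_monomials
    (initial_ideal (@lex m) (@toric_ideal n m K e)).
Proof.
move=> red_sqf.
exists (fun q => exists2 w, squarefree_mnm w /\ lex_reducible w & q = 'X_[w]).
split=> [q [w [sw _] ->]|p]; first by exists w.
split=> -[r [c [g [gS ->]]]]; last first.
  exists r, c, g; split=> // i.
  have [w [_ /(initial_lex_reducible K)[q [tq iq]]] ->] := gS i.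
  by exists q, w.
have /fin_all_exists[w wP] : forall i, exists w : 'X_{1..m} * 'X_{1..m},
    [/\ lex_reducible w.1, squarefree_mnm w.1 & g i = 'X_[w.2] * 'X_[w.1]].
  move=> i; have [q [u [tq iq ->]]] := gS i.
  have [|w [rw sw wu]] := red_sqf u.
    by apply/(initial_lex_reducible K); exists q.
  by exists (w, (u - w)%MM); rewrite -mpolyXD submK.
exists r, (fun i => c i * 'X_[(w i).2]), (fun i => 'X_[(w i).1]).
split=> [i|]; first by have [rw sw _] := wP i; exists (w i).1.
by apply: eq_bigr => i _; have [_ _ ->] := wP i; rewrite mulrA.
Qed.
End Monomials.

(** The degrees agree, so the smallest variable in which the two monomials differ decides, and [c]
    is its index. The rank [s^-1%g z] grows as the variable gets smaller. *)
Lemma edge_ltP n (s : 'S_n) (A B : {set 'I_n}) : edge_lt s A B -> #|A| = #|B| ->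
  exists c, [/\ c \in A, c \notin B
    & forall z, (s^-1%g c < s^-1%g z)%N -> (z \in A) = (z \in B)].
Proof.
case/andP=> nAB + cAB; rewrite /edge_le /degrevlex /edge_mnm.
rewrite (inj_eq (@inj_mesym1 n)) (negPf nAB) !mdeg_mesym1 cAB ltnn eqxx /=.
move=> /existsP[k /andP[/forallP agree]].
rewrite !mnmE => ltk; exists (s k); split.
- by move: ltk; case: (s k \in A) => //; rewrite ltn0.
- by move: ltk; case: (s k \in B) => //; case: (s k \in A).
move=> z; rewrite permK => kz; have := agree (s^-1%g z).
by rewrite kz permKV !mnmE /=; case: (z \in A); case: (z \in B).
Qed.

(** * The monomial of a closed walk *)

Section WalkMonomials.
Variables (n m : nat) (e : m.-tuple {set 'I_n}).
Hypothesis e_inj : injective (tnth e).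
Hypothesis e_edge : forall i, #|tnth e i| = 2%N.
Variables (red bl : rel 'I_n) (k : 'I_m).
Hypothesis bl_edge : forall x y, bl x y ->
  exists2 j : 'I_m, (k < j)%N & tnth e j = [set x; y].

(** On a closed walk with distinct red edges, this is the image of both the product of the red edges
    and that of the blue ones. *)
Definition walk_ends (s : seq ('I_n * 'I_n)) : 'X_{1..n} :=
  (\sum_(d <- s) (U_(d.1) + U_(d.2)))%MM.

Lemma edge_neq i x y : tnth e i = [set x; y] -> x != y.
Proof. by move=> ei; have := e_edge i; rewrite ei cards2; case: (x == y). Qed.

(** The product of the blue edges serves as [w]: they meet each end of each dart once, and [x] and
    [y] once more. *)
Lemma awalk_blue_mnm x s y : awalk red bl x s y ->
  exists2 w : 'X_{1..m}, (forall j : 'I_m, (j <= k)%N -> w j = 0%N)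
    & edge_image e w = (U_(x) + walk_ends s + U_(y))%MM.
Proof.
have step x' y' : bl x' y' -> exists2 w : 'X_{1..m},
    (forall j : 'I_m, (j <= k)%N -> w j = 0%N)
    & edge_image e w = (U_(x') + U_(y'))%MM.
  move=> /bl_edge[j kj ej]; exists U_(j)%MM => [i ik|].
    by rewrite mnm1E; case: eqP => // ji; move: kj; rewrite ji ltnNge ik.
  by rewrite edge_imageU ej edge_mnm2 // (edge_neq ej).
elim: s x => [|d s IH] x /=.
  by move=> /step[w w0 ew]; exists w; rewrite // /walk_ends big_nil addm0.
case/and3P=> /step[w1 w10 ew1] _ /IH[w2 w20 ew2].
exists (w1 + w2)%MM => [j jk|]; first by rewrite mnmDE w10 ?w20.
by rewrite edge_imageD ew1 ew2 /walk_ends big_cons !addmA.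
Qed.

Definition walk_mnm (s : seq ('I_n * 'I_n)) : 'X_{1..m} :=
  [multinom (tnth e j \in map (@dart_edge _) s : nat) | j < m].

Lemma edge_image_walk_mnm s : uniq (map (@dart_edge _) s) ->
  {subset map (@dart_edge _) s <= e} ->
  edge_image e (walk_mnm s) = walk_ends s.
Proof.
move=> us se; rewrite /edge_image.
have -> : (\sum_i edge_mnm (tnth e i) *+ walk_mnm s i)%MM =
    (\sum_(A <- e | A \in map (@dart_edge _) s) edge_mnm A)%MM.
  rewrite big_tuple [RHS]big_mkcond /=; apply: eq_bigr => i _.
  by rewrite mnmE; case: (_ \in _).
rewrite -big_filter (perm_big (map (@dart_edge _) s)); last first.
  apply: uniq_perm => //; first by apply: filter_uniq; apply/tuple_uniqP.
  by move=> A; rewrite mem_filter /=; apply: andb_idr => /se.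
rewrite big_map /walk_ends big_seq_cond [RHS]big_seq_cond.
apply: eq_bigr => d /andP[ds _]; rewrite edge_mnm2 //.
have /tnthP[i ei] := se _ (map_f (@dart_edge _) ds).
by apply: (@edge_neq i); rewrite -ei.
Qed.

(** The product [w] of the blue edges has the same image and involves only variables smaller than
    [y_k], while [walk_mnm s] involves [y_k]. *)
Lemma closed_awalk_reducible s : closed_awalk red bl s ->
  uniq (map (@dart_edge _) s) -> {subset map (@dart_edge _) s <= e} ->
  tnth e k \in map (@dart_edge _) s -> lex_reducible e (walk_mnm s).
Proof.
move=> cs us se ks.
have [w w0 ew] : exists2 w : 'X_{1..m},
    (forall j : 'I_m, (j <= k)%N -> w j = 0%N)
    & edge_image e w = walk_ends s.
  case: s cs {us se ks} => //= d s /andP[_ /awalk_blue_mnm[w w0 ew]].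
  by exists w; rewrite // ew /walk_ends big_cons addmC addmA.
have wk : (w k < walk_mnm s k)%N by rewrite w0 // mnmE ks.
have [j0 j0w j0min] : exists2 j : 'I_m, (w j < walk_mnm s j)%N
    & forall i : 'I_m, (w i < walk_mnm s i)%N -> (j <= i)%N.
  pose P j := (w j < walk_mnm s j)%N.
  by case: (arg_minnP (P := P) (@nat_of_ord m) wk) => j; exists j.
exists w; split; last 2 first.
- by apply: contraTneq wk => ->; rewrite ltnn.
- by rewrite ew edge_image_walk_mnm.
apply/orP; right; apply/existsP; exists j0; rewrite j0w andbT.
(* Before [j0], which is at most [k], [w] vanishes, and by the choice of [j0] so does
   [walk_mnm s]. *)
apply/forallP => i; apply/implyP => ij0.
have : ~~ (w i < walk_mnm s i)%N.
  by apply: contraTN ij0 => /j0min; rewrite -leqNgt.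
have ik : (i <= k)%N := leq_trans (ltnW ij0) (j0min k wk).
by rewrite w0 // lt0n negbK eq_sym.
Qed.

End WalkMonomials.

(** * Gap-free graphs *)

Lemma lex_reducible_squarefree n m (E : {set {set 'I_n}}) (s : 'S_n)
    (e : m.-tuple {set 'I_n}) (u : 'X_{1..m}) :
  simple_graph E -> gap_free E -> decreasing_edge_naming s E e ->
  lex_reducible e u ->
  exists w, [/\ lex_reducible e w, squarefree_mnm w & (w <= u)%MM].
Proof.
move=> simpE gapE [eE e_lt] [v [+ nvu euv]].
rewrite /lex (negPf nvu) /= => /existsP[k /andP[/forallP agree vuk]].
have e_edge i : #|tnth e i| = 2%N by apply: simpE; rewrite -eE mem_tnth.
have e_inj : injective (tnth e).
  move=> i j eij; apply/val_inj; case: (ltngtP i j) => // /e_lt /andP[];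
  by rewrite eij eqxx.
pose h (i : 'I_m) : int := (u i)%:Z - (v i)%:Z.
have balanced x : \sum_(i | x \in tnth e i) h i = 0.
  have /mnmP/(_ x) := euv; rewrite !edge_imageE => uvx.
  have PoszE (f : 'I_m -> nat) :
    \sum_(i | x \in tnth e i) (f i)%:Z = (\sum_(i | x \in tnth e i) f i)%N%:Z.
    by rewrite (big_morph _ PoszD (erefl _)).
  by rewrite sumrB !PoszE uvx subrr.
pose pos (z : 'I_n) : nat := s^-1%g z.
have [a [b [ek ab]]] : exists a b, tnth e k = [set a; b] /\ (pos a < pos b)%N.
  have /eqP/cards2P[x [y [nxy ->]]] := e_edge k.
  case: (ltngtP (pos x) (pos y)) => [xy|yx|/val_inj/perm_inj xy].
  - by exists x, y.
  - by exists y, x; rewrite setUC.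
  - by rewrite xy eqxx in nxy.
pose big z := (pos b < pos z)%N.
pose red := pos_edge (tnth e) h.
pose adj x y := [set x; y] \in E.
(* Every edge after [k] counts as blue, whatever the sign of [h], so that the edges supplied by
   gap-freeness qualify. *)
pose bl x y := [exists j : 'I_m, (k < j)%N && (tnth e j == [set x; y])].
have setC (x y : 'I_n) : [set x; y] = [set y; x] by rewrite setUC.
have adjP x y : adj x y -> exists i, tnth e i = [set x; y].
  by rewrite /adj -eE => /tnthP[i ->]; exists i.
have redP x y : red x y ->
    exists i : 'I_m, [/\ (k <= i)%N, (0 < u i)%N & tnth e i = [set x; y]].
  case/existsP=> i /andP[hi /eqP ei]; exists i; split=> //.
    rewrite leqNgt; apply/negP => ik; have := agree i; rewrite ik => /eqP vui.
    by move: hi; rewrite /h vui subrr ltxx.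
  by move: hi; rewrite /h; lia.
have blP x y : bl x y -> exists2 i : 'I_m, (k < i)%N & tnth e i = [set x; y].
  by case/existsP=> i /andP[ki /eqP ei]; exists i.
have neg_bl : subrel (neg_edge (tnth e) h) bl.
  move=> x y /existsP[i /andP[hi ei]]; apply/existsP; exists i.
  rewrite ei andbT.
  rewrite ltnNge leq_eqVlt; apply/negP => /orP[/eqP/val_inj ik|ik].
    by move: hi; rewrite /h ik; lia.
  have := agree i; rewrite ik => /eqP vui.
  by move: hi; rewrite /h vui subrr ltxx.
have hk : 0 < h k by rewrite /h; lia.
have redC : ssrbool.symmetric red by move=> x y; rewrite /red /pos_edge setC.
have blC : ssrbool.symmetric bl by move=> x y; rewrite /bl setC.
have adj_irr : irreflexive adj.
  by move=> x; apply/negP => /simpE; rewrite setUid cards1.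
have red_adj : subrel red adj.
  by move=> x y /redP[i [_ _ ei]]; rewrite /adj -eE -ei mem_tnth.
have bl_adj : subrel bl adj.
  by move=> x y /blP[i _ ei]; rewrite /adj -eE -ei mem_tnth.
(* A red or blue edge avoiding [b] is strictly below [e_k]. The smallest variable in which they
   differ belongs to an end of that edge, and lies beyond [b] since they differ at [b]. *)
have big_cover x y : red x y || bl x y -> x != b -> y != b -> big x || big y.
  move=> rbxy xb yb.
  have [i ki ei] : exists2 i : 'I_m, (k <= i)%N & tnth e i = [set x; y].
    case/orP: rbxy => [/redP[i [ki _ ei]]|/blP[i ki ei]]; exists i => //.
    exact: ltnW.
  have bNi : b \notin tnth e i by rewrite ei !inE negb_or !(eq_sym b) xb.
  have {}ki : (k < i)%N.
    rewrite ltn_neqAle ki andbT; apply: contraNneq bNi => /val_inj <-.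
    by rewrite ek !inE eqxx orbT.
  have [|c [ci cNk later]] := edge_ltP (e_lt _ _ ki); first by rewrite !e_edge.
  suff bc : big c.
    by move: ci; rewrite ei !inE => /orP[] /eqP<-; rewrite bc ?orbT.
  rewrite /big ltnNge leq_eqVlt; apply/negP.
  case/orP=> [/eqP/val_inj/perm_inj cb|/later].
    by move: cNk; rewrite cb ek !inE eqxx orbT.
  by rewrite (negPf bNi) ek !inE eqxx orbT.
(* An edge above [e_k] agrees with it at all vertices beyond some end of [e_k], hence at all big
   vertices; but [e_k] has no big end. *)
have big_bl x y : adj x y -> big x || big y -> bl x y.
  case/adjP=> i ei bxy; apply/existsP; exists i; rewrite ei eqxx andbT.
  have [z zi bz] : exists2 z, z \in tnth e i & big z.
    by case/orP: bxy => ?; [exists x|exists y]; rewrite // ei !inE eqxx ?orbT.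
  have zNk : z \notin tnth e k.
    rewrite ek !inE negb_or; apply/andP; split; apply: contraTneq bz => ->.
      by rewrite /big -leqNgt ltnW.
    by rewrite /big ltnn.
  rewrite ltnNge leq_eqVlt; apply/negP => /orP[/eqP/val_inj ik|ik].
    by rewrite ik (negPf zNk) in zi.
  have [|c [ck cNi later]] := edge_ltP (e_lt _ _ ik); first by rewrite !e_edge.
  have : (pos c < pos z)%N.
    apply: leq_ltn_trans bz.
    by move: ck; rewrite ek !inE => /orP[] /eqP-> //; apply: ltnW.
  by move/later; rewrite zi (negPf zNk).
have red_ab : red a b by apply/existsP; exists k; rewrite hk ek eqxx.
have [t /(awalk_sub neg_bl) wt] := balanced_awalk e_edge balanced hk ek.
have c0 : closed_awalk red bl ((a, b) :: t) by rewrite /= red_ab.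
have ab0 : through_ab a b ((a, b) :: t) by rewrite /through_ab mem_head.
have [t' [ct' abt' ut']] := exists_uniq_closed_awalk redC blC adj_irr gapE
  red_adj bl_adj big_cover big_bl c0 ab0.
have t'e A : A \in map (@dart_edge _) t' ->
    exists i : 'I_m, (0 < u i)%N /\ tnth e i = A.
  by case/mapP=> d /(closed_awalk_red ct')/redP[i [_ ui ei]] ->; exists i.
exists (walk_mnm e t'); split.
- apply: (closed_awalk_reducible e_inj e_edge blP ct' ut').
    by move=> A /t'e[i [_ <-]]; apply: mem_tnth.
  rewrite ek; case/orP: abt' => abt'; apply/mapP; first by exists (a, b).
  by exists (b, a); rewrite // setC.
- by move=> i; rewrite mnmE; case: (_ \in _).
(* Red edges have positive exponent in [u], and exponents of [walk_mnm] are at most 1. *)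
- apply/mnm_lepP => i; rewrite mnmE; case: (boolP (_ \in _)) => // /t'e[j [uj]].
  by move/e_inj <-.
Qed.

Theorem theorem3p9 (K : fieldType) (n m : nat) (E : {set {set 'I_n}})
    (s : 'S_n) (e : m.-tuple {set 'I_n}) :
  simple_graph E -> no_isolated_vertex E -> gap_free E -> #|E| = m ->
  decreasing_edge_naming s E e ->
  generated_by_squarefree_monomials
    (initial_ideal (@lex m) (@toric_ideal n m K e)).
Proof.
move=> simpE _ gapE _ eE.
apply: generated_by_squarefree_of_reducible => u.
exact: lex_reducible_squarefree eE.
Qed.
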